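(* Let $G$ be a finite nonabelian group with center $Z$. Then at least one of the maximally abelian subgroups of $G$ is not an eigenheimer of $G$; that is, there exists a maximally abelian subgroup $H$ of $G$ with $N_G(H) \neq H$.
   Context: A maximally abelian subgroup of a group $G$ is an abelian subgroup of $G$ that is not properly contained in any other abelian subgroup of $G$. A subgroup $H \neq G$ of a group $G$ is called an eigenheimer of $G$ (or self-normalizing) if its normalizer in $G$ equals itself, i.e. $N_G(H) = H$. *)

(* Defs.v *)
From mathcomp Require Import all_boot all_fingroup.

Set Implicit Arguments.
Unset Strict Implicit.
Unset Printing Implicit Defensive.

Import GroupScope.

Section EigenDefs.

Variable gT : finGroupType.
Implicit Types G H : {group gT}.

Definition maximally_abelian G H : bool :=
  [max H of K | (K \subset G) && abelian K].

(* Self-normalizing proper subgroup. Properness is part of the notion: G itself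
   always satisfies 'N_G(G) = G. *)
Definition eigenheimer G H : bool := (H \proper G) && ('N_G(H) == H).

End EigenDefs.

(* Main.v *)
Require Import Defs.
From mathcomp Require Import all_boot all_fingroup.
From mathcomp Require Import zify.
From mathcomp Require Import center frobenius.

Set Implicit Arguments.
Unset Strict Implicit.
Unset Printing Implicit Defensive.

Import GroupScope.

(** Centralizers of noncentral elements carry the proof. If [x] is noncentral
    and ['C_G[x]] is nonabelian, the maximal abelian subgroups of ['C_G[x]] all
    contain [x], hence are maximal abelian in [G] as well
    ([maximally_abelian_cent1]); normalizers only grow from ['C_G[x]] to [G],
    so induction on [#|G|] applies.

    Otherwise every noncentral element has an abelian centralizer, which is
    then maximal abelian ([maximally_abelian_cent1_abelian]). In such a group
    two of these centralizers that share a noncentral element coincide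
    ([cent1_eq_of_mem]). Were they all self-normalizing, each set
    ['C_G[x] :\: 'Z(G)] would be a trivial intersection set with normalizer
    ['C_G[x]], so its conjugates would be [#|G : 'C_G[x]|] disjoint sets, and,
    as [#|'Z(G)| <= #|'C_G[x]| / 2], they would fill at least half of [G]
    ([half_support]), though not all of [G :\: 'Z(G)]. A noncentral [y]
    outside them yields a second such family disjoint from the first, and both
    together would fill all of [G], including the identity. *)

Section CentralizersOfNoncentralElements.

Variable gT : finGroupType.
Implicit Types (G H : {group gT}) (x y : gT).

Lemma noncentralP G x :
  reflect (x \in G /\ ~~ (G \subset 'C[x])) (x \in G :\: 'Z(G)).
Proof.
rewrite !inE -sub_cent1.
by case: (x \in G); rewrite ?andbF ?andbT; apply: (iffP idP) => // -[].
Qed.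

Lemma cent1_proper G x : x \in G :\: 'Z(G) -> 'C_G[x] \proper G.
Proof.
by case/noncentralP=> _; rewrite properE subsetIl subsetI subxx.
Qed.

Lemma center_sub_cent1 G x : x \in G -> 'Z(G) \subset 'C_G[x].
Proof. by move=> Gx; rewrite setIS // -cent_set1 centS // sub1set. Qed.

(** A maximal abelian subgroup of ['C_G[x]] contains [x], as [x] is central in
    ['C_G[x]]; hence every abelian subgroup of [G] above it centralizes [x]
    and already lies in ['C_G[x]]. *)
Lemma maximally_abelian_cent1 G H x :
  x \in G -> maximally_abelian 'C_G[x] H -> maximally_abelian G H.
Proof.
move=> Gx /maxgroupP[/andP[sHC abH] maxH].
(* H absorbs x: the group generated by H and x is abelian inside 'C_G[x] *)
have Hx : x \in H.
  rewrite -(maxH (H <*> <[x]>)%G) ?joing_subl //.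
    by rewrite mem_gen // inE cycle_id orbT.
  rewrite join_subG sHC cycle_subG inE Gx cent1id /=.
  rewrite abelianY abH cycle_abelian cycle_subG -sub_cent1.
  exact: subset_trans sHC (subsetIr _ _).
apply/maxgroupP; split=> [|K /andP[sKG abK] sHK].
  by rewrite abH (subset_trans sHC (subsetIl _ _)).
apply: maxH => //; rewrite abK andbT subsetI sKG.
by rewrite sub_cent1 (subsetP abK) // (subsetP sHK).
Qed.

Lemma maximally_abelian_cent1_abelian G x :
  x \in G -> abelian 'C_G[x] -> maximally_abelian G 'C_G[x].
Proof.
move=> Gx abC; apply/(maximally_abelian_cent1 Gx)/maxgroupP.
split=> [|K /andP[sKC _] sCK]; first by rewrite subxx.
by apply/eqP; rewrite eqEsubset sKC.
Qed.

End CentralizersOfNoncentralElements.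

Section AbelianCentralizers.

Variables (gT : finGroupType) (G : {group gT}).
Hypothesis abC : {in G :\: 'Z(G), forall x, abelian 'C_G[x]}.

Local Notation noncentral_cent1 x := ('C_G[x] :\: 'Z(G)).

Lemma noncentral_cent1_sub x : noncentral_cent1 x \subset G :\: 'Z(G).
Proof. by rewrite setSD // subsetIl. Qed.

(** If [y] is in the abelian group ['C_G[x]] then ['C_G[x]] centralizes [y];
    since also [x] is in ['C_G[y]], the argument is symmetric. *)
Lemma cent1_eq_of_mem x y :
  x \in G :\: 'Z(G) -> y \in noncentral_cent1 x -> 'C_G[y] = 'C_G[x].
Proof.
(* abelianness of 'C_G[u] forces 'C_G[u] to centralize each of its elements *)
have half u v : u \in G :\: 'Z(G) -> v \in 'C_G[u] -> 'C_G[u] \subset 'C_G[v].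
  by move=> ncu Cv; rewrite subsetI subsetIl sub_cent1 (subsetP (abC ncu)).
move=> ncx Cy; have ncy := subsetP (noncentral_cent1_sub x) y Cy.
have /setDP[Cxy _] := Cy; apply/eqP; rewrite eqEsubset !half //.
have /setDP[Gx _] := ncx; rewrite inE Gx cent1C.
by case/setIP: Cxy.
Qed.

Lemma noncentralJ x g : g \in G -> (x ^ g \in G :\: 'Z(G)) = (x \in G :\: 'Z(G)).
Proof.
move=> Gg; apply/memJ_norm/(subsetP _ g Gg).
by rewrite normsD ?normG ?normal_norm ?center_normal.
Qed.

Lemma cent1_conj x g : g \in G -> 'C_G[x ^ g] = 'C_G[x] :^ g.
Proof. by move=> Gg; rewrite conjIg cent1J conjGid. Qed.

Lemma mem_noncentral_cent1 x :
  x \in G :\: 'Z(G) -> x \in noncentral_cent1 x.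
Proof. by case/setDP=> Gx nZx; rewrite !in_setD nZx inE Gx cent1id. Qed.

Lemma mem_noncentral_cent1E x y :
  (y \in noncentral_cent1 x) = (y \in 'C_G[x]) && (y \in G :\: 'Z(G)).
Proof.
rewrite in_setD [y \in 'C_G[x]]in_setI in_setD.
by case: (y \in G); rewrite ?andbF ?andbT //= andbC.
Qed.

Lemma normedTI_noncentral_cent1 x :
    x \in G :\: 'Z(G) -> 'N_G('C_G[x]) = 'C_G[x] ->
  normedTI (noncentral_cent1 x) G 'C_G[x].
Proof.
move=> ncx selfN; apply/normedTI_memJ_P; split; last 1 first.
- move=> a g Ca Gg; have ECa := cent1_eq_of_mem ncx Ca.
  apply/idP/idP => [Cag | Cg].
    (* a and a ^ g have the same centralizer, so g normalizes it *)
    rewrite /= -selfN inE Gg; apply/normP.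
    by rewrite -{1}ECa -cent1_conj // (cent1_eq_of_mem ncx Cag).
  (* g centralizes a, because 'C_G[a] = 'C_G[x] *)
  move: Cg; rewrite /= -{1}ECa => /setIP[_].
  by rewrite cent1C => /cent1P/commgP/conjg_fixP->.
- by apply/set0Pn; exists x; apply: mem_noncentral_cent1.
- exact: subsetIl.
Qed.

(** Conjugates of ['C_G[x]] and ['C_G[y]] sharing a noncentral element are
    equal, both being the centralizer of that element; so a conjugate of [y]
    lies in ['C_G[x]]. This makes the support of [x] disjoint
    from that of any noncentral [y] outside it. *)
Lemma mem_support_of_meet x y z :
    x \in G :\: 'Z(G) -> y \in G :\: 'Z(G) ->
    z \in class_support (noncentral_cent1 x) G ->
    z \in class_support (noncentral_cent1 y) G ->
  y \in class_support (noncentral_cent1 x) G.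
Proof.
move=> ncx ncy /imset2P[a g Ca Gg ->] /imset2P[b h Cb Gh Eab].
have Gk : h * g^-1 \in G by rewrite groupM ?groupV.
have Ea : a = b ^ (h * g^-1) by rewrite conjgM -Eab conjgK.
rewrite -(conjgK (h * g^-1) y) memJ_class_support ?groupV //.
rewrite mem_noncentral_cent1E noncentralJ // ncy andbT.
rewrite -(cent1_eq_of_mem ncx Ca) Ea cent1_conj // (cent1_eq_of_mem ncy Cb).
by rewrite memJ_conjg; case/setDP: (mem_noncentral_cent1 ncy).
Qed.

(** Each of the [#|G : 'C_G[x]|] conjugates of ['C_G[x]] contributes its
    [#|'C_G[x]| - #|'Z(G)|] noncentral elements, with no overlap. *)
Lemma card_support x :
    x \in G :\: 'Z(G) -> 'N_G('C_G[x]) = 'C_G[x] ->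
  #|class_support (noncentral_cent1 x) G| + #|'Z(G)| * #|G : 'C_G[x]| = #|G|.
Proof.
move=> ncx selfN.
have sZC : 'Z(G) \subset 'C_G[x] by case/setDP: ncx => /center_sub_cent1.
rewrite (card_support_normedTI (normedTI_noncentral_cent1 ncx selfN)).
rewrite cardsD (setIidPr sZC) -mulnDl subnK ?subset_leq_card //.
by rewrite Lagrange ?subsetIl.
Qed.

(** The index of ['Z(G)] in ['C_G[x]] is at least [2], since [x] is in
    ['C_G[x]] but not in ['Z(G)]. *)
Lemma half_support x :
    x \in G :\: 'Z(G) -> 'N_G('C_G[x]) = 'C_G[x] ->
  #|G| <= 2 * #|class_support (noncentral_cent1 x) G|.
Proof.
move=> ncx selfN.
have /setDP[Cx nZx] := mem_noncentral_cent1 ncx.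
have sZC : 'Z(G) \subset 'C_G[x] by case/setDP: ncx => /center_sub_cent1.
have prZC : 1 < #|'C_G[x] : 'Z(G)|.
  by rewrite indexg_gt1; apply: contra nZx => /subsetP->.
have : 2 * (#|'Z(G)| * #|G : 'C_G[x]|) <= #|G|.
  rewrite -(Lagrange (subsetIl G 'C[x])) -(Lagrange sZC) mulnA leq_mul2r.
  by rewrite mulnC leq_mul2l prZC !orbT.
have := card_support ncx selfN; lia.
Qed.

(** Two disjoint supports, each of at least half the order of [G], cannot fit in
    [G] minus its center. *)
Lemma exists_cent1_not_selfnormal :
  ~~ abelian G ->
  exists2 x, x \in G :\: 'Z(G) & 'N_G('C_G[x]) != 'C_G[x].
Proof.
move=> nabG; apply/exists_inP; apply: contraT => /exists_inPn selfN.
have {}selfN x : x \in G :\: 'Z(G) -> 'N_G('C_G[x]) = 'C_G[x].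
  by move/selfN; rewrite negbK => /eqP.
pose S x := class_support (noncentral_cent1 x) G.
have sSG x : S x \subset G :\: 'Z(G).
  apply/subsetP=> _ /imset2P[a g Ca Gg ->].
  by rewrite noncentralJ // (subsetP (noncentral_cent1_sub x)).
have [x ncx] : exists x, x \in G :\: 'Z(G).
  apply/set0Pn; rewrite setD_eq0; apply: contra nabG => sGZ.
  exact: abelianS sGZ (center_abelian G).
(* G minus its center has #|G| - #|'Z(G)| elements and S x only
   #|G| - #|'Z(G)| * #|G : 'C_G[x]|, where the index exceeds 1 *)
have [y ncy nSy] : exists2 y, y \in G :\: 'Z(G) & y \notin S x.
  apply/subsetPn; apply/negP => /subset_leq_card.
  rewrite cardsD (setIidPr (center_sub G)) leq_subLR.
  rewrite -(card_support ncx (selfN x ncx)) -/(S x) addnC leq_add2r.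
  rewrite -{2}[#|'Z(G)|]muln1 leq_pmul2l ?cardG_gt0 // leqNgt indexg_gt1.
  by case/andP: (cent1_proper ncx) => _ ->.
have dSS : [disjoint S x & S y].
  rewrite -setI_eq0; apply: contraR nSy => /set0Pn[z /setIP[]].
  exact: mem_support_of_meet.
have : #|S x :|: S y| < #|G|.
  apply/proper_card/(@sub_proper_trans _ _ (G :\: 'Z(G))).
    by rewrite subUset !sSG.
  rewrite properE subsetDl; apply/subsetPn.
  by exists 1; rewrite ?group1 // inE group1.
rewrite cardsU (disjoint_setI0 dSS) cards0 subn0.
have := half_support ncx (selfN x ncx); have := half_support ncy (selfN y ncy).
rewrite -/(S x) -/(S y); lia.
Qed.

End AbelianCentralizers.

Theorem mainTheorem1 (gT : finGroupType) (G : {group gT})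
    (nabG : ~~ abelian G) :
  exists H : {group gT},
    [/\ maximally_abelian G H, ~~ eigenheimer G H & 'N_G(H) <> H :> {set gT}].
Proof.
have [n] := ubnP #|G|; elim: n => // n IHn in G nabG *; rewrite ltnS => leGn.
suffices [H maxH nNH] : exists2 H : {group gT},
    maximally_abelian G H & 'N_G(H) != H.
  by exists H; split=> //; [rewrite /eigenheimer negb_and nNH orbT | apply/eqP].
have [/exists_inP[x ncx nabC] | /exists_inPn abC] :=
  boolP [exists x in G :\: 'Z(G), ~~ abelian 'C_G[x]].
  have /setDP[Gx _] := ncx.
  have [|H [maxH _ nNH]] := IHn 'C_G[x]%G nabC.
    exact: leq_trans (proper_card (cent1_proper ncx)) leGn.
  exists H; first exact: maximally_abelian_cent1 Gx maxH.
  (* if H were its own normalizer in G, then also in 'C_G[x] *)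
  apply: contra_notN nNH => /eqP NH.
  have /maxgroupP[/andP[sHC _] _] := maxH.
  by rewrite /= setIAC NH (setIidPl (subset_trans sHC (subsetIr _ _))).
have {}abC : {in G :\: 'Z(G), forall x, abelian 'C_G[x]}.
  by move=> x /abC; rewrite negbK.
have [x ncx nNC] := exists_cent1_not_selfnormal abC nabG.
exists 'C_G[x]%G => //; have /setDP[Gx _] := ncx.
exact: maximally_abelian_cent1_abelian Gx (abC x ncx).
Qed.
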